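(* Let $k$ be a positive integer and let $G$ be a connected graph without $k$-suppressible vertices. If $\mathrm{ola}^+(G)\le k$, then $G$ has at most $5k+2$ vertices and at most $6k+1$ edges.
   Context: All graphs are finite, without loops or parallel edges. A linear arrangement of $G=(V,E)$ is a bijection $\alpha:V\to\{1,\dots,|V|\}$; net cost $\mathrm{nc}(\alpha,G)=\sum_{uv\in E}(|\alpha(u)-\alpha(v)|-1)$; $\mathrm{ola}^+(G)$ is the minimum net cost. An edge $e$ is a bridge if $G-e$ has more components than $G$. For a connected graph $G$ and positive integer $k$, a bridge $e$ is $k$-separating if both connected components of $G-e$ have more than $k$ vertices. A vertex $v$ of degree 2 with neighbors $u_1,u_2$ such that $u_1u_2\notin E(G)$ is $k$-suppressible if both edges $vu_1,vu_2$ are $k$-separating bridges. *)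

(* Defs.v *)
From mathcomp Require Import all_boot.

Set Implicit Arguments.
Unset Strict Implicit.
Unset Printing Implicit Defensive.

Record sgraph := SGraph {
  vertex :> finType;
  adj : rel vertex;
  adj_sym : symmetric adj;
  adj_irrefl : irreflexive adj
}.

Definition edges (G : sgraph) : {set {set G}} :=
  [set [set p.1; p.2] | p : G * G & adj p.1 p.2].

Definition neighbors (G : sgraph) (v : G) : {set G} := [set u | adj v u].

Section DeleteEdge.

Variables (G : sgraph) (e : {set G}).

Definition del_adj : rel G := fun x y => adj x y && ([set x; y] != e).

Lemma del_adj_sym : symmetric del_adj.
Proof. by move=> x y; rewrite /del_adj adj_sym setUC. Qed.

Lemma del_adj_irrefl : irreflexive del_adj.
Proof. by move=> x; rewrite /del_adj adj_irrefl. Qed.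

Definition del_edge : sgraph := SGraph del_adj_sym del_adj_irrefl.

End DeleteEdge.

Definition component (G : sgraph) (x : G) : {set G} :=
  [set y | connect (@adj G) x y].

Definition components (G : sgraph) : {set {set G}} :=
  [set component x | x : G].

Definition connected (G : sgraph) : bool := #|components G| == 1.

Definition bridge (G : sgraph) (e : {set G}) : bool :=
  (e \in edges G) && (#|components G| < #|components (del_edge e)|).

(* When G is connected and e is a bridge, G - e has exactly two components. *)
Definition separating_bridge (k : nat) (G : sgraph) (e : {set G}) : bool :=
  bridge e && [forall C in components (del_edge e), k < #|C|].

Definition suppressible (k : nat) (G : sgraph) (v : G) : Prop :=
  exists u1 u2 : G,
    [/\ u1 != u2, neighbors v = [set u1; u2], ~~ adj u1 u2,
        separating_bridge k [set v; u1] & separating_bridge k [set v; u2]].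

(* Positions are numbered 0, ..., |V| - 1 rather than 1, ..., |V|; the net cost
   only depends on differences of positions. *)
Definition linear_arrangement (G : sgraph) (a : {ffun G -> 'I_#|G|}) : bool :=
  injectiveb a && [forall i, i \in codom a].

(* Truncated subtraction makes this |a u - a v| on e = {u, v}; see
   [edge_length2]. *)
Definition edge_length (G : sgraph) (a : {ffun G -> 'I_#|G|}) (e : {set G}) :
    nat :=
  \max_(u in e) \max_(v in e) (a u - a v).

Lemma edge_length2 (G : sgraph) (a : {ffun G -> 'I_#|G|}) (u v : G) :
  edge_length a [set u; v] = maxn (a u - a v) (a v - a u).
Proof.
have max2 (F : G -> nat) : \max_(w in [set u; v]) F w = maxn (F u) (F v).
  have [->|uv] := eqVneq u v; first by rewrite setUid big_set1 maxnn.
  by rewrite big_setU1 ?inE //= big_set1.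
by rewrite /edge_length max2 !max2 !subnn max0n maxn0.
Qed.

Definition net_cost (G : sgraph) (a : {ffun G -> 'I_#|G|}) : nat :=
  \sum_(e in edges G) (edge_length a e - 1).

Definition default_arrangement (G : sgraph) : {ffun G -> 'I_#|G|} :=
  [ffun v => enum_rank v].

Lemma default_arrangementP (G : sgraph) :
  linear_arrangement (default_arrangement G).
Proof.
apply/andP; split; first by apply/injectiveP=> u v; rewrite !ffunE => /enum_rank_inj.
apply/forallP=> i; apply/codomP; exists (enum_val i).
by rewrite ffunE enum_valK.
Qed.

Definition ola_plus (G : sgraph) : nat :=
  net_cost [arg min_(a < default_arrangement G | linear_arrangement a)
              net_cost a].

Lemma ola_plusP (G : sgraph) :
  (exists2 a, linear_arrangement a & @net_cost G a = ola_plus G)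
  /\ (forall a, linear_arrangement a -> ola_plus G <= @net_cost G a).
Proof.
rewrite /ola_plus; case: arg_minnP; first exact: default_arrangementP.
by move=> a la amin; split=> //; exists a.
Qed.

(* Main.v *)
Require Import Defs.
From mathcomp Require Import all_boot zify.

(** Fix an arrangement of net cost at most [k].  The net cost counts the pairs
    (edge, vertex) such that the edge jumps over the vertex, so at most [k]
    vertices are jumped over.  If three consecutive vertices [u1, v, u2] are not
    jumped over, then [v u1] and [v u2] are the only edges across the two gaps
    around [v]; hence [v] is [k]-suppressible as soon as each gap has more than
    [k] vertices on both sides.  At most [3k] positions are within distance one
    of a vertex that is jumped over, so each of the [n - 2k - 2] central
    positions being of that kind forces [n <= 5k + 2].  Edges of length one are
    at most [n - 1], the others at most [k]. *)

Set Implicit Arguments.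
Unset Strict Implicit.
Unset Printing Implicit Defensive.

Lemma connect_adj_sym (G : sgraph) : connect_sym (@adj G).
Proof. by apply: sym_connect_sym; apply: adj_sym. Qed.

(** * Connectedness, edge cuts and bridges *)

Section Connectivity.

Variable G : sgraph.

Lemma adj_edge (u v : G) : adj u v -> [set u; v] \in edges G.
Proof. by move=> uv; apply/imsetP; exists (u, v); rewrite ?inE. Qed.

Lemma edgesP (e : {set G}) :
  reflect (exists u v : G, adj u v /\ e = [set u; v]) (e \in edges G).
Proof.
apply: (iffP imsetP) => [[[u v]]|[u [v [uv ->]]]]; last exact/imsetP/adj_edge.
by rewrite inE /= => uv ->; exists u, v.
Qed.

Hypothesis G_conn : connected G.

Lemma connected_connect (x y : G) : connect (@adj G) x y.
Proof.
have /cards1P [C defC] := G_conn.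
have inC z : component z = C.
  by apply/set1P; rewrite -defC; apply: imset_f.
have : y \in component y by rewrite inE connect0.
by rewrite inC -(inC x) inE.
Qed.

Lemma connected_gt0 : 0 < #|G|.
Proof.
have /cards1P [C defC] := G_conn.
have : C \in components G by rewrite defC set11.
by case/imsetP=> x _ _; apply/card_gt0P; exists x.
Qed.

Lemma connected_crossing (L : {set G}) (x y : G) :
  x \in L -> y \notin L -> exists u v : G, [/\ adj u v, u \in L & v \notin L].
Proof.
move=> xL yL; have [p px ey] := connectP (connected_connect x y).
elim: p x xL px ey => [|z p IHp] x xL /= => [_ exy|/andP [xz pz] ey].
  by rewrite exy xL in yL.
have [zL|zL] := boolP (z \in L); first exact: IHp zL pz ey.
by exists x, z.
Qed.

(** Once [xy], the only edge leaving [L], is deleted, no path changes side, while every vertex still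
    reaches [x] or [y] on its own side. So the components are exactly [L] and its complement. *)
Lemma sole_crossing_separating (k : nat) (L : {set G}) (x y : G) :
  adj x y -> x \in L -> y \notin L ->
  (forall u v : G, adj u v -> u \in L -> v \notin L -> u = x /\ v = y) ->
  k < #|L| -> k < #|~: L| -> separating_bridge k [set x; y].
Proof.
move=> xy xL yL sole kL kL'.
pose H := del_edge [set x; y].
have adjH (u v : G) : adj u v -> (u \in L) = (v \in L) -> @adj H u v.
  move=> uv eL; rewrite /= /del_adj uv /=; apply/eqP => eE.
  have : x \in [set u; v] by rewrite eE !inE eqxx.
  have : y \in [set u; v] by rewrite eE !inE eqxx orbT.
  by rewrite !inE => /orP [] /eqP ey /orP [] /eqP ex;
    move: xL yL; rewrite ex ey ?eL => ->.
have Hclosed : closed (@adj H) (mem L).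
  apply: (intro_closed (@connect_adj_sym H)).
  move=> u v /= /andP [uv neq] uL; apply: contraNT neq => vL.
  by have [-> ->] := sole u v uv uL vL.
have toL (z : G) :
    if z \in L then connect (@adj H) z x else connect (@adj H) z y.
  have [p pz ex] := connectP (connected_connect z x).
  elim: p z pz ex => [|z' p IHp] z /= => [_ <-|/andP [zz' pz'] ex].
    by rewrite xL connect0.
  have := IHp z' pz' ex; case: ifP => z'L; case: ifP => zL.
  - by apply: connect_trans; apply: connect1; apply: adjH; rewrite ?zL ?z'L.
  - have := sole z' z; rewrite adj_sym => /(_ zz' z'L).
    by rewrite zL => /(_ isT) [_ ->]; rewrite connect0.
  - by have := sole z z' zz' zL; rewrite z'L => /(_ isT) [-> _]; rewrite connect0.
  - by apply: connect_trans; apply: connect1; apply: adjH; rewrite ?zL ?z'L.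
have compH (z : H) : component z = if z \in L then L else ~: L.
  apply/setP => w; rewrite inE; apply/idP/idP => [zw|].
    have := closed_connect Hclosed zw; rewrite /= => ezw.
    by case: ifP ezw => _ ezw; rewrite ?inE -ezw.
  have := toL z; have := toL w; case: (boolP (z \in L)) => zL;
    rewrite ?inE; case: (boolP (w \in L)) => //= wL cw cz _;
    by apply: connect_trans cz _; rewrite (@connect_adj_sym H).
have compsH : components H = [set L; ~: L].
  apply/setP => C; rewrite !inE; apply/imsetP/orP => [[z _ ->]|].
    by rewrite compH; case: ifP => _; [left|right].
  case=> /eqP ->; [exists x|exists y] => //; rewrite compH ?xL //.
  by rewrite (negPf yL).
have neqL : L != ~: L by apply/eqP => /setP /(_ x); rewrite inE xL.
apply/andP; split; last first.
  apply/forallP => C; apply/implyP; rewrite -/H compsH !inE.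
  by case/orP=> /eqP ->.
rewrite /bridge adj_edge //= -/H compsH cards2 neqL.
by rewrite (eqP G_conn).
Qed.

End Connectivity.

(** * Counting positions and jumped-over vertices *)

Section Arrangement.

Variables (G : sgraph) (a : {ffun G -> 'I_#|G|}).
Hypothesis a_lin : linear_arrangement a.

Lemma arrangement_inj (u v : G) : a u = a v :> nat -> u = v.
Proof. by case/andP: a_lin => /injectiveP a_inj _ /val_inj /a_inj. Qed.

Lemma arrangement_surj (i : nat) : i < #|G| -> exists v : G, a v = i :> nat.
Proof.
move=> lti; case/andP: a_lin => _ /forallP /(_ (Ordinal lti)) /codomP [v ev].
by exists v; rewrite -ev.
Qed.

Lemma card_position_le (A : {set G}) (s : seq nat) :
  (forall v, v \in A -> (a v : nat) \in s) -> #|A| <= size s.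
Proof.
move=> As; rewrite cardE -(size_map (fun v => a v : nat)).
apply: uniq_leq_size => [|_ /mapP [v + ->]]; last by rewrite mem_enum; apply: As.
by rewrite map_inj_uniq ?enum_uniq // => u v; apply: arrangement_inj.
Qed.

Lemma card_position_lt (i : nat) : i <= #|G| -> i <= #|[set v | a v < i]|.
Proof.
move=> lei; rewrite -{1}(size_iota 0 i) cardE -(size_map (fun v => a v : nat)).
apply: uniq_leq_size (iota_uniq _ _) _ => j; rewrite mem_iota /= => ltj.
have [v ev] := arrangement_surj (leq_trans ltj lei).
by apply/mapP; exists v; rewrite // mem_enum inE ev.
Qed.

Lemma card_position_ge (i : nat) : #|G| - i <= #|[set v | i <= a v]|.
Proof.
rewrite -{1}(size_iota i (#|G| - i)) cardE -(size_map (fun v => a v : nat)).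
apply: uniq_leq_size (iota_uniq _ _) _ => j; rewrite mem_iota => /andP [lej ltj].
have [|v ev] := @arrangement_surj j; first by lia.
by apply/mapP; exists v; rewrite // mem_enum inE ev.
Qed.

(** Both ends range over [e], so the edge needs no orientation. *)
Definition jumped (e : {set G}) : {set G} :=
  [set w | [exists u in e, exists v in e, a u < a w < a v]].

Lemma card_jumped (u v : G) :
  #|jumped [set u; v]| <= edge_length a [set u; v] - 1.
Proof.
wlog uv : u v / a u <= a v.
  by case: (leqP (a u) (a v)) => [|/ltnW] uv; last rewrite setUC; apply.
rewrite edge_length2.
rewrite -(size_iota (a u).+1 (maxn (a u - a v) (a v - a u) - 1)).
apply: card_position_le => w; rewrite inE mem_iota.
case/existsP=> x /andP [+ /existsP [y /andP []]].
by rewrite !inE => /orP [] /eqP -> /orP [] /eqP ->; lia.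
Qed.

Definition covered : {set G} := \bigcup_(e in edges G) jumped e.

(** Union bound: a vertex jumped over by several edges counts once on the left and once per edge on
    the right. *)
Lemma card_covered : #|covered| <= net_cost a.
Proof.
rewrite /covered /net_cost.
elim/big_rec2: _ => [|e n A /edgesP [u [v [_ ->]]] le_An]; first by rewrite cards0.
by rewrite (leq_trans (leq_card_setU _ _)) // leq_add ?card_jumped.
Qed.

Lemma uncovered_le (w u v : G) :
  w \notin covered -> adj u v -> a u < a w -> a v <= a w.
Proof.
move=> + uv uw; apply: contraNT; rewrite -ltnNge => wv.
apply/bigcupP; exists [set u; v]; first exact: adj_edge.
rewrite inE; apply/existsP; exists u; rewrite !inE eqxx /=.
by apply/existsP; exists v; rewrite !inE eqxx orbT uw wv.
Qed.

(** * Gaps between consecutive uncovered vertices *)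

Section Gap.

Variables (x y : G).
Hypotheses (x_unc : x \notin covered) (y_unc : y \notin covered).
Hypothesis xy_next : a y = (a x).+1 :> nat.

(** An edge starting before [x] would jump over [x], and one ending after [y] would jump over
    [y]. *)
Lemma gap_crossing (u v : G) : adj u v -> a u <= a x -> a x < a v -> u = x /\ v = y.
Proof.
move=> uv ux xv; have := @uncovered_le _ _ _ x_unc uv.
have := @uncovered_le _ _ _ y_unc uv; rewrite xy_next => hy hx.
by split; apply: arrangement_inj; rewrite ?xy_next; lia.
Qed.

Hypothesis G_conn : connected G.

Lemma gap_adj : adj x y.
Proof.
have [||u [v [uv]]] := @connected_crossing G G_conn [set w | a w <= a x] x y.
- by rewrite inE.
- by rewrite inE xy_next ltnn.
- by rewrite !inE -ltnNge => ux xv; have [<- <-] := gap_crossing uv ux xv.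
Qed.

(** Positions start at 0, so the sides of the gap have [a x + 1] and [#|G| - a y] vertices. *)
Lemma gap_separating (k : nat) :
  k <= a x -> k + a y < #|G| -> separating_bridge k [set x; y].
Proof.
move=> kx ky; apply: (@sole_crossing_separating _ G_conn _ [set w | a w <= a x]).
- exact: gap_adj.
- by rewrite inE.
- by rewrite inE xy_next ltnn.
- by move=> u v uv; rewrite !inE -ltnNge; apply: gap_crossing.
- by apply: leq_trans (card_position_lt (ltn_ord (a x))); rewrite ltnS.
- rewrite (_ : ~: _ = [set w | a y <= a w]); last first.
    by apply/setP=> w; rewrite !inE -ltnNge xy_next.
  by apply: leq_trans (card_position_ge _); lia.
Qed.

End Gap.

Lemma uncovered_suppressible (k : nat) (u1 v u2 : G) :
  connected G ->
  u1 \notin covered -> v \notin covered -> u2 \notin covered ->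
  a v = (a u1).+1 :> nat -> a u2 = (a v).+1 :> nat ->
  k <= a u1 -> k + a u2 < #|G| -> suppressible k v.
Proof.
move=> G_conn unc1 unc unc2 ev e2 k1 k2; exists u1, u2.
have adj1 := gap_adj unc1 unc ev G_conn.
have adj2 := gap_adj unc unc2 e2 G_conn.
split.
- by apply/eqP => eu; move: e2; rewrite -eu; lia.
(* A neighbor of [v] on its left crosses the gap before [v], one on its right the gap after [v]. *)
- apply/setP => w; rewrite !inE; apply/idP/orP => [vw|].
    have [wv|vw'|] := ltngtP (a w) (a v).
    + left; apply/eqP; rewrite adj_sym in vw.
      by have [||-> //] := gap_crossing unc1 unc ev vw; lia.
    + by right; apply/eqP; have [||_ -> //] := gap_crossing unc unc2 e2 vw; lia.
    + by move=> /arrangement_inj ew; rewrite ew adj_irrefl in vw.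
  by case=> /eqP -> //; rewrite adj_sym.
(* An edge [u1 u2] would jump over [v]. *)
- by apply/negP => u12; have := uncovered_le unc u12; lia.
- by rewrite setUC; apply: gap_separating => //; lia.
- by apply: gap_separating => //; lia.
Qed.

Lemma card_vertices_le (k : nat) :
  connected G -> (forall v : G, ~ suppressible k v) ->
  #|G| <= 2 * k + 2 + 3 * #|covered|.
Proof.
move=> G_conn nosupp.
(* Repeated or out-of-range entries, as at position 0, are harmless: only the length of [s]
   matters. *)
pose near (w : G) : seq nat := [:: (a w).-1; a w : nat; (a w).+1].
pose s := flatten [seq near w | w <- enum covered].
have size_s : size s = 3 * #|covered|.
  by rewrite /s cardE; elim: (enum _) => //= w t ->; lia.
suff : #|G| - (2 * k + 2) <= size s by lia.
(* These are the [j] with [k <= j - 1] and [k + (j + 1) < #|G|], as suppressibility at [j]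
   requires. *)
rewrite -(size_iota k.+1 (#|G| - (2 * k + 2))).
apply: uniq_leq_size (iota_uniq _ _) _ => j; rewrite mem_iota => /andP [kj jk].
have [|v ev] := @arrangement_surj j; first by lia.
have [|u1 e1] := @arrangement_surj j.-1; first by lia.
have [|u2 e2] := @arrangement_surj j.+1; first by lia.
have near_s w : w \in covered -> j \in near w -> j \in s.
  by move=> wc jw; apply/flattenP; exists (near w) => //; apply: map_f; rewrite mem_enum.
have [/near_s|unc1] := boolP (u1 \in covered).
  by apply; rewrite !inE e1; lia.
have [/near_s|unc] := boolP (v \in covered).
  by apply; rewrite !inE ev; lia.
have [/near_s|unc2] := boolP (u2 \in covered).
  by apply; rewrite !inE e2; lia.
by case: (nosupp v); apply: (uncovered_suppressible G_conn unc1 unc unc2); lia.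
Qed.

Lemma card_edges_le : connected G -> #|edges G| <= #|G|.-1 + net_cost a.
Proof.
move=> /connected_gt0 /card_gt0P [x0 _].
pose short := [set e in edges G | edge_length a e <= 1].
(* Inverse of [a]; the default [x0] is returned only for [i] outside the range of positions. *)
pose pos i := odflt x0 [pick v | (a v : nat) == i].
have posK v : pos (a v) = v.
  rewrite /pos; case: pickP => [w /eqP /arrangement_inj //|/(_ v)].
  by rewrite eqxx.
have le_short : #|short| <= #|G|.-1.
  (* A short edge is determined by its left end, which is never in the last position. *)
  rewrite -(size_iota 0 #|G|.-1).
  rewrite -(size_map (fun i => [set pos i; pos i.+1])) cardE.
  apply: uniq_leq_size (enum_uniq _) _ => e; rewrite mem_enum inE.
  case/andP=> /edgesP [u [v [uv ->]]].
  wlog leuv : u v uv / a u <= a v.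
    case: (leqP (a u) (a v)) => [|/ltnW] leuv; first exact.
    by rewrite setUC; apply; rewrite // adj_sym.
  rewrite edge_length2 => len.
  have neuv : a u <> a v :> nat.
    by move=> /arrangement_inj euv; rewrite euv adj_irrefl in uv.
  have ev : a v = (a u).+1 :> nat by lia.
  apply/mapP; exists (a u : nat); last by rewrite -ev !posK.
  by rewrite mem_iota; have := ltn_ord (a v); lia.
(* Each remaining edge contributes at least 1 to the net cost. *)
have le_long : #|edges G :\: short| <= net_cost a.
  rewrite /net_cost (big_setID short) /= -sum1_card.
  apply: leq_trans (leq_addl _ _); apply: leq_sum => e; rewrite !inE.
  by case/andP=> + eE; rewrite eE /=; lia.
rewrite -(cardsID short (edges G)) leq_add //.
by apply: leq_trans le_short; apply: subset_leq_card; apply: subsetIr.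
Qed.

End Arrangement.

Theorem theorem2p10 (k : nat) (k_gt0 : 0 < k) (G : sgraph)
    (G_conn : connected G)
    (G_nosupp : forall v : G, ~ suppressible k v)
    (ola_le : ola_plus G <= k) :
  #|G| <= 5 * k + 2 /\ #|edges G| <= 6 * k + 1.
Proof.
have [[a a_lin cost_a] _] := ola_plusP G.
have := card_vertices_le a_lin G_conn G_nosupp.
have := card_covered a_lin; have := card_edges_le a_lin G_conn.
(* The vertex bound is [2k + 2 + 3k]; the edge bound is [(5k + 1) + k]. *)
lia.
Qed.
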